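(* Let $n$ be a non-negative integer, let $a,x$ be non-zero complex numbers, let $b\in\mathbb{C}$, and let $\lambda\in\mathbb{C}$ satisfy $\lambda\neq 0$ and $(\lambda;\lambda)_n\neq 0$. Then $$(x-b)_\lambda^n=\sum_{k=0}^{n}\genfrac{[}{]}{0pt}{}{n}{k}_{\lambda}\lambda^{2\binom{k}{2}}\left(\lambda^{1-n}\frac{b}{a}\right)^k(a-b)_\lambda^{n-k}(x-a)_\lambda^k.$$
   Context: For $y\neq 0$ and $c\in\mathbb{C}$: $(y-c)_\lambda^0=1$ and $(y-c)_\lambda^k=\prod_{j=0}^{k-1}\left(1-\frac{c}{\lambda^j y}\right)$ for $k\ge 1$ (not an ordinary power). $(q;q)_0=1$, $(q;q)_m=\prod_{j=1}^m(1-q^j)$, and the $q$-binomial coefficient is $\genfrac{[}{]}{0pt}{}{n}{k}_{q}=\frac{(q;q)_n}{(q;q)_k(q;q)_{n-k}}$. *)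

(* Defs.v *)
From HB Require Import structures.
From mathcomp Require Import all_boot all_order all_algebra.

Set Implicit Arguments.
Unset Strict Implicit.
Unset Printing Implicit Defensive.

Import Order.TTheory GRing.Theory Num.Theory.
Local Open Scope ring_scope.

(* (y - c)_lam^k.  It depends on the pair (y, c), not on the difference y - c,
   and is meant for lam != 0 and y != 0. *)
Definition lampow (F : fieldType) (lam y c : F) (k : nat) : F :=
  \prod_(0 <= j < k) (1 - c / (lam ^+ j * y)).

(* (q; q)_m *)
Definition qpoch (F : fieldType) (q : F) (m : nat) : F :=
  \prod_(1 <= j < m.+1) (1 - q ^+ j).

(* Meant for k <= n and (q; q)_n != 0; the latter makes both factors of the
   denominator nonzero. *)
Definition qbinom (F : fieldType) (q : F) (n k : nat) : F :=
  qpoch q n / (qpoch q k * qpoch q (n - k)).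

(* Main.v *)
Require Import Defs.
From HB Require Import structures.
From mathcomp Require Import all_boot all_order all_algebra.
From mathcomp Require Import reals complex.
From mathcomp Require Import ring zify.

Set Implicit Arguments.
Unset Strict Implicit.
Unset Printing Implicit Defensive.

Import Order.TTheory GRing.Theory Num.Theory.
Local Open Scope ring_scope.
Local Open Scope complex_scope.

(* Multiplying the k-th term of the expansion of order n by the next factor
   [1 - b / (lam^n x)], split as
   [(1 - b / (lam^(n-k) a)) + b / (lam^(n-k) a) * (1 - a / (lam^k x))],
   feeds the terms k and k+1 of the expansion of order n+1. The coefficients
   [n, k]_lam * lam^(-k(n-k)), i.e. the 1/lam-binomials, obey the matching
   Pascal rule. *)

Lemma lampow0 (F : fieldType) (lam y c : F) : lampow lam y c 0 = 1.
Proof. by rewrite /lampow big_geq. Qed.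

Lemma lampowS (F : fieldType) (lam y c : F) k :
  lampow lam y c k.+1 = lampow lam y c k * (1 - c / (lam ^+ k * y)).
Proof. by rewrite /lampow big_nat_recr. Qed.

Lemma qpochS (F : fieldType) (q : F) m :
  qpoch q m.+1 = qpoch q m * (1 - q ^+ m.+1).
Proof. by rewrite /qpoch big_nat_recr. Qed.

Lemma qpoch_neq0_le (F : fieldType) (q : F) m n :
  (m <= n)%N -> qpoch q n != 0 -> qpoch q m != 0.
Proof.
move=> /subnK <-; elim: (n - m)%N => [//|d IH].
by rewrite addSn qpochS mulf_eq0 negb_or => /andP[/IH].
Qed.

Lemma qbinom0 (F : fieldType) (q : F) n : qpoch q n != 0 -> qbinom q n 0 = 1.
Proof. by move=> h; rewrite /qbinom subn0 [qpoch q 0]big_geq // mul1r divff. Qed.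

Lemma qbinomn (F : fieldType) (q : F) n : qpoch q n != 0 -> qbinom q n n = 1.
Proof. by move=> h; rewrite /qbinom subnn [qpoch q 0]big_geq // mulr1 divff. Qed.

(** With [n = m + k + 1], cancelling common factors leaves [1 - q^(m+k+2) = (1 - q^(m+1)) q^(k+1) +
    (1 - q^(k+1))]. *)
Lemma qbinomS (F : fieldType) (q : F) n k :
  (k < n)%N -> qpoch q n != 0 ->
  qbinom q n.+1 k.+1 = qbinom q n k.+1 * q ^+ k.+1 + qbinom q n k.
Proof.
move=> /subnK <-; move: (n - k.+1)%N => m {n} h.
have hk : qpoch q k.+1 != 0 by apply: qpoch_neq0_le h; lia.
have hm : qpoch q m.+1 != 0 by apply: qpoch_neq0_le h; lia.
rewrite /qbinom.
have -> : ((m + k.+1).+1 - k.+1 = m.+1)%N by lia.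
have -> : (m + k.+1 - k.+1 = m)%N by lia.
have -> : (m + k.+1 - k = m.+1)%N by lia.
move: hk hm; rewrite !qpochS !mulf_eq0 !negb_or => /andP[hk hk1] /andP[hm hm1].
rewrite -addSn exprD.
by field; rewrite hk hk1 hm hm1.
Qed.

Definition lamcoef (F : fieldType) (lam : F) (n k : nat) : F :=
  qbinom lam n k / lam ^+ (k * (n - k)).

(** The exponents of [lam] add up: [k(k-1) + k(1-n) = -k(n-k)]. *)
Lemma lamcoefE (F : fieldType) (lam : F) n k (t : F) :
  lam != 0 -> (k <= n)%N ->
  qbinom lam n k * lam ^+ (2 * 'C(k, 2)) * (lam ^ (1 - n%:Z) * t) ^+ k
  = lamcoef lam n k * t ^+ k.
Proof.
move=> hlam hk; rewrite exprMn mulrA; congr (_ * _).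
rewrite /lamcoef -mulrA; congr (_ * _).
(* Since [1 - n] may be negative, all powers of [lam] are merged into one with an integer
   exponent. *)
rewrite [(_ ^ _) ^+ k]exprnP exprz_exp exprnN [lam ^+ _]exprnP -expfzDr //.
congr (_ ^ _).
have -> : (2 * 'C(k, 2) = k * k.-1)%N.
  rewrite mulnC muln2 bin2 even_halfK // oddM.
  by case: k {hk} => //= k; case: odd.
nia.
Qed.

(** This is [qbinomS] divided by [lam^((k+1)(n-k))]; the exponent is split in a different way for
    each summand. *)
Lemma lamcoefS (F : fieldType) (lam : F) n k :
  lam != 0 -> (k < n)%N -> qpoch lam n != 0 ->
  lamcoef lam n.+1 k.+1
  = lamcoef lam n k.+1 + lamcoef lam n k / lam ^+ (n - k).
Proof.
move=> hlam hk hq; rewrite /lamcoef qbinomS // subSS.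
have -> : (k.+1 * (n - k) = k * (n - k) + (n - k))%N by lia.
(* The summand [k.+1] isolates the power that cancels the factor [lam^(k+1)] of the Pascal rule. *)
have e : (k * (n - k) + (n - k) = k.+1 + k.+1 * (n - k.+1))%N by nia.
rewrite mulrDl; congr (_ + _).
  by rewrite e exprD invfM mulrA mulfK // expf_neq0.
by rewrite exprD invfM mulrA.
Qed.

Lemma lampow_expansion (F : fieldType) (lam a b x : F) n :
  a != 0 -> x != 0 -> lam != 0 -> qpoch lam n != 0 ->
  lampow lam x b n =
  \sum_(k < n.+1) lamcoef lam n k * (b / a) ^+ k
    * lampow lam a b (n - k) * lampow lam x a k.
Proof.
move=> ha hx hlam; elim: n => [|n IH] hq.
  by rewrite big_ord1 /lamcoef qbinom0 // !lampow0 !expr0 divr1 !mulr1.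
have hqn : qpoch lam n != 0 by apply: qpoch_neq0_le hq.
have coef0 m : qpoch lam m != 0 -> lamcoef lam m 0 = 1.
  by move=> h; rewrite /lamcoef qbinom0 // divr1.
have coefn m : qpoch lam m != 0 -> lamcoef lam m m = 1.
  by move=> h; rewrite /lamcoef qbinomn // subnn muln0 divr1.
rewrite lampowS IH // mulr_suml.
(* [A k] is what the k-th term contributes to index k of the next order, [B k] what it contributes
   to index k+1. *)
pose A k := lamcoef lam n k * (b / a) ^+ k
  * lampow lam a b (n.+1 - k) * lampow lam x a k.
pose B k := lamcoef lam n k / lam ^+ (n - k) * (b / a) ^+ k.+1
  * lampow lam a b (n - k) * lampow lam x a k.+1.
rewrite (eq_bigr (fun k : 'I_n.+1 => A k + B k)); last first.
  move=> [k /= hk] _; rewrite /A /B subSn // !lampowS exprS.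
  have -> : lam ^+ n = lam ^+ (n - k) * lam ^+ k by rewrite -exprD subnK.
  have h1 := expf_neq0 (n - k) hlam; have h2 := expf_neq0 k hlam.
  by field; rewrite ha hx h1 h2.
(* [A 0] and [B n] have no partner; as extreme coefficients equal 1, they are the first and last
   terms of order n+1. *)
rewrite big_split /= big_ord_recl [X in _ + X]big_ord_recr /=.
rewrite [RHS]big_ord_recl [X in _ = _ + X]big_ord_recr /=.
rewrite {1}/A {2}/B /bump /= !coef0 // !coefn // !subnn divr1.
rewrite -!addrA; congr (_ + _); rewrite addrA -big_split /=; congr (_ + _).
(* [A (k+1)] and [B k] share all factors but the coefficients, which add up by the Pascal rule. *)
apply: eq_bigr => -[k /= hk] _; rewrite /A /B !add1n lamcoefS // !subSS.
ring.
Qed.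

Theorem theorem7 (R : realType) (n : nat) (a x b lam : R[i])
    (ha : a != 0) (hx : x != 0) (hlam : lam != 0) (hq : qpoch lam n != 0) :
  lampow lam x b n =
  \sum_(0 <= k < n.+1)
    qbinom lam n k * lam ^+ (2 * 'C(k, 2)) * (lam ^ (1 - n%:Z) * (b / a)) ^+ k
      * lampow lam a b (n - k) * lampow lam x a k.
Proof.
rewrite big_mkord (lampow_expansion b ha hx hlam hq).
by apply: eq_bigr => -[k hk] _; rewrite lamcoefE.
Qed.
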